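(* Let $d\ge 3$ and let $F \leq \mathrm{Sym}(\{1,\dots,d\})$ be primitive but not cyclic of prime order. Then for each end $\xi\in\partial T_d$ the group $U(F)^+$ has the relative Howe--Moore property with respect to its closed subgroup $(U(F)^+)_\xi^0 := \{g\in U(F)^+ \mid g(\xi)=\xi \text{ and } g \text{ is elliptic}\}$.
   Context: $T_d$ is the $d$-regular tree, $d\ge 3$, $\partial T_d$ its set of ends, and $\mathrm{Aut}(T_d)$ is its automorphism group with the compact-open topology. A legal coloring of $T_d$ is a map $\iota$ from the set of unoriented edges of $T_d$ to $\{1,\dots,d\}$ whose restriction to the star $E(x)$ (the set of edges containing $x$) is a bijection onto $\{1,\dots,d\}$ for every vertex $x$. Fix such an $\iota$. For $F\le \mathrm{Sym}(\{1,\dots,d\})$, $U(F):=\{g\in \mathrm{Aut}(T_d) \mid \iota\circ g\circ(\iota|_{E(x)})^{-1}\in F \text{ for every vertex } x\}$, and $U(F)^+$ is the subgroup of $U(F)$ generated by those elements of $U(F)$ which fix some edge of $T_d$ pointwise. It is a closed subgroup of $\mathrm{Aut}(T_d)$, hence a locally compact group. ''Primitive'' refers to the action of $F$ on $\{1,\dots,d\}$. An element fixing an end is elliptic if it fixes a vertex of $T_d$. A unitary representation $(\pi,\mathcal{H})$ of a locally compact group $G$ is a strongly continuous homomorphism $\pi:G\to\mathcal{U}(\mathcal{H})$, with $\mathcal{H}$ an (infinite-dimensional) complex Hilbert space. Its matrix coefficients are the functions $c_{v,w}(g)=\langle\pi(g)v,w\rangle$; $c_{v,w}$ vanishes at infinity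 if for every $\epsilon>0$ the set $\{g\in G \mid |c_{v,w}(g)|\ge\epsilon\}$ is compact. For a closed subgroup $H\le G$, the pair $(G,H)$ has the relative Howe--Moore property ($G$ has the relative Howe--Moore property with respect to $H$) if for every unitary representation $(\pi,\mathcal{H})$ of $G$, either $\mathcal{H}$ has non-zero $H$-invariant vectors, or all matrix coefficients of the restriction $\pi|_H$ vanish at infinity on $H$. *)

(* Defs.v *)
From HB Require Import structures.
From mathcomp Require Import all_boot all_order all_algebra.
From mathcomp Require Import fingroup perm.
From mathcomp Require Import sesquilinear complex.
From mathcomp Require Import all_classical all_reals all_analysis.

Set Implicit Arguments.
Unset Strict Implicit.
Unset Printing Implicit Defensive.

Import Order.TTheory GRing.Theory Num.Theory.
Import numFieldNormedType.Exports.

Local Open Scope classical_set_scope.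
Local Open Scope group_scope.

HB.mixin Record isTopologicalGroup G & monoid.Group G & Topological G := {
  mulg_continuous : continuous (fun x : G * G => x.1 * x.2 : G);
  invg_continuous : continuous (fun x : G => x^-1 : G)
}.

#[short(type="topGroupType")]
HB.structure Definition TopologicalGroup :=
  {G of monoid.Group G & Topological G & isTopologicalGroup G}.

Record subgroup (G : groupType) := Subgroup {
  subgroup_set :> set G;
  subgroup_closed : group_closed [in subgroup_set] }.

Section SubgroupGroup.
Variables (G : groupType) (H : subgroup G).
Local Notation K := (set_type H).

Let memM (x y : K) : \val x * \val y \in (H : set G).
Proof. exact: (group_closedM (subgroup_closed H)) (valP x) (valP y). Qed.
Let memV (x : K) : (\val x)^-1 \in (H : set G).
Proof. exact: (group_closedV (subgroup_closed H)) (valP x). Qed.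

Let one : K := SigSub (subgroup_closed H).1.
Let mul (x y : K) : K := SigSub (memM x y).
Let inv (x : K) : K := SigSub (memV x).

Let mulA : associative mul.
Proof. by move=> x y z; apply/val_inj; exact: mulgA. Qed.
Let mul1 : left_id one mul.
Proof. by move=> x; apply/val_inj; exact: mul1g. Qed.
Let mul1r : right_id one mul.
Proof. by move=> x; apply/val_inj; exact: mulg1. Qed.
Let mulV : left_inverse one inv mul.
Proof. by move=> x; apply/val_inj; exact: mulVg. Qed.
Let mulVr : right_inverse one inv mul.
Proof. by move=> x; apply/val_inj; exact: mulgV. Qed.

HB.instance Definition _ := isGroup.Build K mulA mul1 mul1r mulV mulVr.

End SubgroupGroup.

Section SubgroupTopology.
Variables (G : topGroupType) (H : subgroup G).
Local Notation K := (set_type H).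

Let val_continuous : continuous (\val : K -> G).
Proof. exact: initial_continuous. Qed.

Let mulK : continuous (fun x : K * K => x.1 * x.2 : K).
Proof.
apply: (@continuous_comp_initial K _ _ \val) => x.
apply: (@continuous_comp _ _ G (fun y : K * K => (\val y.1 : G, \val y.2 : G))
  (fun y : G * G => y.1 * y.2)); last exact: mulg_continuous.
apply: cvg_pair => /=.
- apply: (@continuous_comp _ K G fst \val x); last exact: val_continuous.
  exact: cvg_fst.
- apply: (@continuous_comp _ K G snd \val x); last exact: val_continuous.
  exact: cvg_snd.
Qed.

Let invK : continuous (fun x : K => x^-1 : K).
Proof.
apply: (@continuous_comp_initial K _ _ \val) => x.
exact: (@continuous_comp K G G \val (fun y => y^-1) x (@val_continuous x)
  (@invg_continuous G _)).
Qed.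

HB.instance Definition _ := isTopologicalGroup.Build K mulK invK.

End SubgroupTopology.

Record regularTree (d : nat) := RegularTree {
  vertex :> choiceType;
  adj : rel vertex;
  adj_sym : symmetric adj;
  adj_irr : irreflexive adj;
  vertex_inhabited : inhabited vertex;
  tree_connected : forall x y, exists2 p, path adj x p & last x p = y;
  (* a duplicate-free closed walk of length at least 3 would be a circuit *)
  tree_acyclic : forall c, uniq c -> path.cycle adj c -> (size c <= 2)%N;
  tree_regular : forall x, ([set y | adj x y] #= `I_d)%card }.
Arguments adj {d} _.

Section Automorphisms.
Variables (d : nat) (T : regularTree d).

Record aut := Aut {
  aut_fun :> T -> T;
  aut_inv : T -> T;
  aut_funK : cancel aut_fun aut_inv;
  aut_invK : cancel aut_inv aut_fun;
  aut_adj : {mono aut_fun : x y / adj T x y} }.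

Lemma autP (g h : aut) : g =1 h -> g = h.
Proof.
case: g h => [g g' gK g'K gadj] [h h' hK h'K hadj] /= /funext gh.
rewrite -{}gh in hK h'K hadj *.
have gh' : g' = h' by apply/funext => x; rewrite -{1}(h'K x) gK.
rewrite -{}gh' in hK h'K *.
by congr Aut; exact: Prop_irrelevance.
Qed.

Let one : aut := @Aut id id (fun=> erefl) (fun=> erefl) (fun _ _ => erefl).

Let mul_adj (g h : aut) : {mono g \o h : x y / adj T x y}.
Proof. by move=> x y /=; rewrite !aut_adj. Qed.
Let mul (g h : aut) : aut :=
  Aut (can_comp (aut_funK g) (aut_funK h))
      (can_comp (aut_invK h) (aut_invK g)) (mul_adj g h).

Let inv_adj (g : aut) : {mono aut_inv g : x y / adj T x y}.
Proof. by move=> x y; rewrite -(aut_adj g) !aut_invK. Qed.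
Let inv (g : aut) : aut := Aut (aut_invK g) (aut_funK g) (inv_adj g).

Let mulA : associative mul.
Proof. by move=> f g h; exact: autP. Qed.
Let mul1 : left_id one mul.
Proof. by move=> g; exact: autP. Qed.
Let mul1r : right_id one mul.
Proof. by move=> g; exact: autP. Qed.
Let mulV : left_inverse one inv mul.
Proof. by move=> g; apply: autP => x; exact: aut_funK. Qed.
Let mulVr : right_inverse one inv mul.
Proof. by move=> g; apply: autP => x; exact: aut_invK. Qed.

HB.instance Definition _ := gen_eqMixin aut.
HB.instance Definition _ := gen_choiceMixin aut.
HB.instance Definition _ := isGroup.Build aut mulA mul1 mul1r mulV mulVr.

(* Automorphisms act on the vertex set, taken as a discrete space; the
   compact-open topology is then that of pointwise convergence (aut_cvgP). *)
Definition aut_map (g : aut) :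
  {compact-open, discrete_topology T -> discrete_topology T} := g.

HB.instance Definition _ := Topological.copy aut (initial_topology aut_map).

Lemma aut_cvgP (F : set_system aut) (g : aut) : Filter F ->
  F --> g <-> forall x, F [set h : aut | h x = g x].
Proof.
move=> FF; split=> [Fg x|Fg U].
  have oU : open [set f : {compact-open, discrete_topology T ->
      discrete_topology T} | f @` [set (x : T)] `<=` [set g x]].
    apply: (@compact_open_open (discrete_topology T) (discrete_topology T)).
      exact: compact_set1.
    exact: discrete_open.
  have : nbhs g (aut_map @^-1` [set f : {compact-open, discrete_topology T ->
      discrete_topology T} | f @` [set (x : T)] `<=` [set g x]]).
    apply: (@initial_continuous aut _ aut_map g); apply: open_nbhs_nbhs.
    by split=> // _ [_ -> <-].
  move=> /Fg; apply: filterS => h hx; exact: hx _ (ex_intro2 _ _ x _ _).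
case=> _ [[W oW <-] Wg] /filterS; apply.
have : (aut_map h @[h --> F]) --> (aut_map g).
  apply/compact_open_cvgP => K O cK oO gO.
  have := cK; rewrite compact_near_coveringP.
  move=> /(_ aut F (fun h x => O (aut_map h x)) FF) K_cover.
  suff : \forall h \near F, K `<=` (fun x => O (aut_map h x)).
    by apply: filterS => h hK _ [x Kx <-]; exact: hK.
  apply: K_cover => x Kx.
  exists ([set x], [set h : aut | h x = g x]).
    by split; [exact: (@discrete_set1 (discrete_topology T) x)|exact: Fg].
  move=> [y h] /= [-> hx]; rewrite /aut_map hx; apply: gO.
  by exists x.
by apply; exact: open_nbhs_nbhs.
Qed.

Let aut_near (g : aut) (x : T) : nbhs g [set h : aut | h x = g x].
Proof. by move: x; apply/aut_cvgP; exact: cvg_id. Qed.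

Let aut_mul_continuous : continuous (fun x : aut * aut => x.1 * x.2 : aut).
Proof.
move=> [g h]; apply/aut_cvgP => x /=.
exists ([set g' : aut | g' (h x) = g (h x)], [set h' : aut | h' x = h x]).
  by split; exact: aut_near.
by move=> [g' h'] /= [gx hx]; rewrite -gx -hx.
Qed.

Let aut_inv_continuous : continuous (fun x : aut => x^-1 : aut).
Proof.
move=> g; apply/(@aut_cvgP _ _ (fmap_filter _ (nbhs_filter g))) => x.
apply: filterS (aut_near g (aut_inv g x)) => h hx.
by apply: (can_inj (aut_funK h)); rewrite /= aut_invK hx aut_invK.
Qed.

HB.instance Definition _ :=
  isTopologicalGroup.Build aut aut_mul_continuous aut_inv_continuous.

End Automorphisms.

Section Coloring.
Variables (d : nat) (T : regularTree d).
Implicit Types (x y : T) (e : set T) (g : aut T) (r s : nat -> T).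

Definition edges : set (set T) :=
  [set e | exists x y, adj T x y /\ e = [set x; y]].

Definition star x : set (set T) := [set e | edges e /\ e x].

(* A coloring is a total function on sets of vertices of which only the values
   on edges matter. *)
Definition legal_coloring (iota : set T -> 'I_d) : Prop :=
  forall x, set_bij (star x) [set: 'I_d] iota.

(* The condition on [s] says s \o iota = iota \o g on the star E(x), that is,
   s is the permutation iota \o g \o (iota|_E(x))^-1 of the colors. *)
Definition universal_group (iota : set T -> 'I_d) (F : {group 'S_d}) :
    set (aut T) :=
  [set g | forall x, exists2 s : 'S_d, s \in F &
    forall e, star x e -> s (iota e) = iota (g @` e)].

Definition fixes_edge g : Prop :=
  exists2 e, edges e & forall x, e x -> g x = x.

Definition ray r : Prop := (forall n, adj T (r n) (r n.+1)) /\ injective r.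

Definition cofinal_rays r s : Prop :=
  exists m n, forall k, r (m + k)%N = s (n + k)%N.

(* An end is an equivalence class of geodesic rays. *)
Definition ends : set (set (nat -> T)) :=
  [set xi | exists2 r, ray r & xi = [set s | ray s /\ cofinal_rays r s]].

Definition aut_end g (xi : set (nat -> T)) : set (nat -> T) :=
  [set g \o r | r in xi].

Definition elliptic g : Prop := exists x, g x = x.

End Coloring.

Section GeneratedSubgroup.
Variables (G : groupType) (S : set G).

Let generated_closed :
  group_closed [in smallest (fun H : set G => group_closed [in H]) S].
Proof.
split=> [|x y]; rewrite !inE.
  by move=> H [[H1 _] _]; exact/set_mem.
move=> Sx Sy H HS; have [[_ HV] _] := HS; apply/set_mem/HV.
- by apply/mem_set; exact: Sx.
- by apply/mem_set; exact: Sy.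
Qed.

Definition generated_subgroup : subgroup G := Subgroup generated_closed.

End GeneratedSubgroup.

Definition universal_group_plus d (T : regularTree d) (iota : set T -> 'I_d)
    (F : {group 'S_d}) : subgroup (aut T) :=
  generated_subgroup (universal_group iota F `&` @fixes_edge d T).

Definition elliptic_end_stabilizer d (T : regularTree d)
    (G : subgroup (aut T)) (xi : set (nat -> T)) : set G :=
  [set g | aut_end (\val g) xi = xi /\ elliptic (\val g)].

Section UnitaryRepresentations.
Local Open Scope ring_scope.
Variable R : realType.

Record hilbertSpace := HilbertSpace {
  hilbert_sort :> completeNormedModType R[i];
  hdot : {dot hilbert_sort for Num.conj};
  hdotE : forall v, `|v| ^+ 2 = hdot v v }.

Definition infinite_dimensional (V : lmodType R[i]) : Prop :=
  ~ exists s : seq V, forall v : V, exists a : nat -> R[i],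
      v = \sum_(i < size s) a i *: s`_i.

Definition unitary_operator (V : hilbertSpace) (u : V -> V) : Prop :=
  [/\ linear u, bijective u & forall v w, hdot V (u v) (u w) = hdot V v w].

Record unitaryRep (G : topGroupType) (V : hilbertSpace) := UnitaryRep {
  rep_fun :> G -> V -> V;
  rep_unitary : forall g, unitary_operator (rep_fun g);
  repM : forall g h v, rep_fun (g * h)%g v = rep_fun g (rep_fun h v);
  rep_continuous : forall v, continuous (rep_fun^~ v) }.

Definition matrix_coef (G : topGroupType) (V : hilbertSpace)
  (pi : unitaryRep G V) (v w : V) (g : G) : R[i] := hdot V (pi g v) w.

Definition vanishes_at_infinity (X : topologicalType) (c : X -> R[i]) : Prop :=
  forall eps : R, 0 < eps -> compact [set x | (eps%:C)%C <= `|c x|].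

Definition relative_howe_moore (G : topGroupType) (H : set G) : Prop :=
  forall (V : hilbertSpace) (pi : unitaryRep G V), infinite_dimensional V ->
    (exists2 v : V, v != 0 & forall h, H h -> pi h v = v) \/
    (forall v w : V,
       vanishes_at_infinity (fun h : set_type H => matrix_coef pi v w (\val h))).

End UnitaryRepresentations.

Definition closed_subgroup (G : topGroupType) (H : set G) : Prop :=
  group_closed [in H] /\ closed H.

(* Main.v *)
Require Import Defs.
From mathcomp Require Import all_boot all_order all_algebra.
From mathcomp Require Import fingroup perm action cyclic primitive_action.
From mathcomp Require Import sesquilinear complex.
From mathcomp Require Import all_classical all_reals all_analysis.
From mathcomp Require Import ring lra.

(** Let H be the group of elliptic elements of G = U(F)^+ that fix the end
    xi, and let x_0, x_1, ... be the vertices of a ray to xi. An elliptic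
    element that fixes xi fixes all x_n with n large, so that H is the
    increasing union of the stabilizers H_n of x_n in H, which are compact
    ([fixer_compact]). Let A_n be the half-tree of all vertices from which
    the way to xi leads through x_n. These half-trees increase and exhaust
    the tree; therefore

    - the pointwise stabilizers K_m of A_m in G shrink to the identity:
      every neighbourhood of the identity contains some K_m
      ([branch_fixer_base]);
    - by Tits' independence property ([universal_group_independence]), an
      element of H is the limit of elements of G supported in the A_n,
      namely of the maps that agree with it on A_n and are the identity
      elsewhere ([branch_supported_dense]);
    - if h in H does not fix x_k, then h(A_k) and A_k are disjoint
      ([moved_branch_disjoint]), so that h^-1 g h belongs to K_m whenever g
      is supported in A_n and m, n <= k.

    A Mautner type argument turns this contraction into the decay of matrix
    coefficients ([howe_moore_criterion]). Up to a small error, v is fixed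
    by some K_m ([near_fixed_vector]). For h outside H_k with k large, pi(h)
    v is then fixed by every element of G supported in A_n, and so its inner
    product with w does not change when w is averaged by such elements. If H
    fixes no nonzero vector, these averages become arbitrarily small for
    suitable n, since the point of minimal norm in the closure of a convex
    set is fixed by every unitary operator that preserves the set
    ([min_norm_point]).

    The tree is handled through the parent map of xi, which sends a vertex
    to the next one on the way to xi ([end_parent]): an automorphism fixes
    xi if and only if it commutes with the parent map, and A_n consists of
    the vertices that some iterate of the parent map sends to x_n. *)

Set Implicit Arguments.
Unset Strict Implicit.
Unset Printing Implicit Defensive.

Import Order.TTheory GRing.Theory Num.Theory.
Import numFieldNormedType.Exports.

(** * Hilbert spaces *)

Section HilbertSpace.
Local Open Scope classical_set_scope.
Local Open Scope ring_scope.
Local Notation "r %:C" := (real_complex _ r).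
Variables (R : realType) (V : hilbertSpace R).
Implicit Types (u v w x y z : V) (C : set V).

Lemma gt0_realC (e : R[i]) : 0 < e -> exists2 r : R, 0 < r & e = r%:C.
Proof.
move=> e0; have /complex_realP[r er] := gtr0_real e0.
by exists r => //; rewrite -ltcR -er.
Qed.

Lemma hdot_conj u v : hdot V u v = (hdot V v u)^*.
Proof. by rewrite hermC expr0 mul1r. Qed.

Lemma hdotBZ a u v : hdot V (u - a *: v) (u - a *: v) =
  hdot V u u - a^* * hdot V u v - a * hdot V v u + a * a^* * hdot V v v.
Proof.
rewrite linearBr linearBl /= linearBl linearZl_LR /= linearZl_LR.
rewrite !linearZr_LR /=.
by rewrite /GRing.scale /=; ring.
Qed.

(** The Cauchy--Schwarz inequality, without any assumption on the dimension. *)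
Lemma cauchy_schwarz u v : `|hdot V u v| <= `|u| * `|v|.
Proof.
rewrite -(@ler_pXn2r _ 2)// ?nnegrE ?mulr_ge0// exprMn.
have [->|v0] := eqVneq v 0.
  by rewrite linear0r !normr0 expr0n mulr0.
have vv0 : 0 < hdot V v v by rewrite dnorm_gt0.
pose a := hdot V u v / hdot V v v.
have av : a * hdot V v v = hdot V u v by rewrite divfK ?gt_eqF.
have : 0 <= hdot V (u - a *: v) (u - a *: v) by exact: dnorm_ge0.
rewrite hdotBZ [a * _ * _]mulrAC av (hdot_conj v u).
rewrite addrAC [hdot V u v * a^*]mulrC subrK subr_ge0.
by rewrite /a mulrAC -normCK ler_pdivrMr// !hdotE.
Qed.

Lemma parallelogram x y :
  `|x - y| ^+ 2 = 2 * `|x| ^+ 2 + 2 * `|y| ^+ 2 - 4 * `|2^-1 *: (x + y)| ^+ 2.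
Proof.
rewrite normrZ exprMn gtr0_norm ?invr_gt0// !hdotE dnormB dnormD.
by field.
Qed.

(** The norm takes its values in the complex numbers, whose order is
    partial; [rnorm] is the same norm with values in the reals. *)
Definition rnorm v : R := complex.Re `|v|.

Lemma rnormE v : `|v| = (rnorm v)%:C.
Proof. by rewrite /rnorm RRe_real. Qed.

Lemma rnorm_ge0 v : 0 <= rnorm v.
Proof. by rewrite -lecR -rnormE normr_ge0. Qed.

Lemma rnorm_parallelogram x y : rnorm (x - y) ^+ 2 =
  2 * rnorm x ^+ 2 + 2 * rnorm y ^+ 2 - 4 * rnorm (2^-1 *: (x + y)) ^+ 2.
Proof.
apply: complexI; rewrite rmorphXn /= -rnormE parallelogram !rnormE.
by rewrite rmorphB rmorphD !rmorphM !rmorph_nat.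
Qed.

(** A nonempty set that is closed under midpoints has a unique point of
    minimal norm in its closure: by the parallelogram law, the points of
    almost minimal norm form a Cauchy filter. Linear isometries that
    preserve the set preserve that filter, hence fix its limit. *)
Lemma min_norm_point C (S : set (V -> V)) : C !=set0 ->
  (forall x y, C x -> C y -> C (2^-1 *: (x + y))) ->
  (forall f, S f -> (forall x, C x -> C (f x)) /\
    [/\ forall x, `|f x| = `|x| & forall x y, `|f x - f y| = `|x - y|]) ->
  exists2 u, closure C u & forall f, S f -> f u = u.
Proof.
move=> [x0 Cx0] Cmid SP.
pose q x : R := rnorm x ^+ 2.
have q_inf : has_inf (q @` C).
  split; [by exists (q x0), x0|by exists 0 => _ [x _ <-]; exact: sqr_ge0].
pose m := inf (q @` C).
have mq x : C x -> m <= q x.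
  by move=> Cx; apply: ge_inf; [case: q_inf|exists x].
(* points whose squared norm is within e of the infimum m *)
pose D (e : R) := [set x | C x /\ q x < m + e].
have D0 e : 0 < e -> D e !=set0.
  move=> e0; have [_ [x Cx <-] qx] := inf_adherent e0 q_inf.
  by exists x.
have Ddiam e x y : D e x -> D e y -> q (x - y) <= 4 * e.
  move=> [Cx qx] [Cy qy].
  have := mq _ (Cmid _ _ Cx Cy).
  have : q (x - y) = 2 * q x + 2 * q y - 4 * q (2^-1 *: (x + y)).
    exact: rnorm_parallelogram.
  lra.
pose F := filter_from [set e : R | 0 < e] D.
have FF : ProperFilter F.
  apply: filter_from_proper; last by move=> e /D0.
  apply: filter_from_filter; first by exists 1 => /=.
  move=> i j i0 j0; exists (Num.min i j) => [|x]; first by rewrite /= lt_min i0.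
  by move=> [Cx qx]; do 2!split => //; apply: lt_le_trans qx _;
    rewrite lerD2l ge_min lexx// orbT.
have Dnorm (r : R) : 0 < r ->
    exists2 e : R, 0 < e & forall x y, D e x -> D e y -> `|x - y| < r%:C.
  move=> r0; exists (r ^+ 2 / 8) => [|x y Dx Dy].
    by rewrite divr_gt0// exprn_gt0.
  rewrite rnormE ltcR -(@ltr_pXn2r _ 2)// ?nnegrE ?rnorm_ge0 ?ltW//.
  apply: le_lt_trans (Ddiam _ _ _ Dx Dy) _.
  have : 0 < r ^+ 2 by rewrite exprn_gt0.
  lra.
have Fcauchy : cauchy F.
  apply: cauchy_exP => _ /gt0_realC[r /Dnorm[e e0 De] ->].
  have [x Dx] := D0 _ e0.
  exists x; exists e => // y Dy; rewrite -ball_normE /=; exact: De.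
pose u := lim F.
have Fu : F --> u by apply: cauchy_cvg.
exists u => [B /Fu[e e0 De]|f Sf].
  by have [x Dx] := D0 _ e0; exists x; split; [case: Dx|exact: De].
have [fC [fn fd]] := SP f Sf.
have fD e x : D e x -> D e (f x).
  by move=> [Cx qx]; split; [exact: fC|rewrite /q /rnorm fn].
apply/eqP; rewrite -subr_eq0 -normr_le0; apply/ler_addgt0Pl => e e0.
have /Fu[i i0 Di] : nbhs u (ball u (e / 2)).
  by apply: nbhsx_ballx; rewrite divr_gt0.
have [x Dx] := D0 _ i0.
have := Di _ Dx; have := Di _ (fD _ _ Dx).
rewrite -!ball_normE /= addr0 => fxu xu; rewrite [e]splitr.
rewrite -(subrK (f x) (f u)) -addrA (le_trans (ler_normD _ _))// lerD// ltW//.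
  by rewrite fd.
by rewrite distrC.
Qed.

End HilbertSpace.

(** * Unitary representations *)

Section Representation.
Local Open Scope classical_set_scope.
Local Open Scope ring_scope.
Local Notation "r %:C" := (real_complex _ r).
Variables (R : realType) (G : topGroupType) (V : hilbertSpace R).
Variable pi : unitaryRep G V.
Implicit Types (g h : G) (u v w x y z : V) (r : R).

Lemma rep_hdot g u v : hdot V (pi g u) (pi g v) = hdot V u v.
Proof. by have [_ _] := rep_unitary pi g. Qed.

Lemma repB g u v : pi g (u - v) = pi g u - pi g v.
Proof.
have [pi_lin _ _] := rep_unitary pi g.
by rewrite -[u - v]addrC -scaleN1r pi_lin scaleN1r addrC.
Qed.

Lemma rep_mid g u v : pi g (2^-1 *: (u + v)) = 2^-1 *: (pi g u + pi g v).
Proof.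
have [pi_lin _ _] := rep_unitary pi g.
have pi0 : pi g 0 = 0 by rewrite -(subrr (0 : V)) repB !subrr.
rewrite -[2^-1 *: _]addr0 pi_lin pi0 addr0; congr (_ *: _).
by rewrite -[u]scale1r pi_lin !scale1r.
Qed.

Lemma rep1 v : pi 1%g v = v.
Proof.
have [_ pi_bij _] := rep_unitary pi 1%g.
by apply: (bij_inj pi_bij); rewrite -repM mulg1.
Qed.

Lemma rep_norm g v : `|pi g v| = `|v|.
Proof.
apply/eqP; rewrite -(@eqrXn2 _ 2)// ?normr_ge0//.
by rewrite !hdotE rep_hdot.
Qed.

Lemma rep_dist g u v : `|pi g u - pi g v| = `|u - v|.
Proof. by rewrite -repB rep_norm. Qed.

Lemma min_norm_fixed (S : set G) (C : set V) : C !=set0 ->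
  (forall x y, C x -> C y -> C (2^-1 *: (x + y))) ->
  (forall g x, S g -> C x -> C (pi g x)) ->
  exists2 u, closure C u & forall g, S g -> pi g u = u.
Proof.
move=> C0 Cmid SC.
have [f [g Sg <-]|u Cu Su] := min_norm_point (S := pi @` S) C0 Cmid.
  by split=> [x|]; [exact: SC|split; [exact: rep_norm|exact: rep_dist]].
by exists u => // g Sg; apply: Su; exists g.
Qed.

(** A vector that a submonoid moves little is close to a vector fixed by it. *)
Lemma near_fixed_vector (K : set G) v r :
  K 1%g -> (forall g h, K g -> K h -> K (g * h)%g) ->
  (forall g, K g -> `|pi g v - v| < r%:C) ->
  exists2 u, `|u - v| <= r%:C & forall g, K g -> pi g u = u.
Proof.
move=> K1 KM Kv.
(* C is invariant under K because K is closed under products, and it lies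
   within r of v because K contains 1 *)
pose C := [set z | forall g, K g -> `|pi g z - v| <= r%:C].
have C0 : C !=set0 by exists v => g /Kv /ltW.
have Cmid x y : C x -> C y -> C (2^-1 *: (x + y)).
  move=> Cx Cy g Kg; rewrite rep_mid.
  have -> : 2^-1 *: (pi g x + pi g y) - v =
      2^-1 *: ((pi g x - v) + (pi g y - v)).
    rewrite addrACA -opprD scalerBr; congr (_ - _).
    by rewrite -mulr2n -(scaler_nat 2 v) scalerA mulVf ?scale1r.
  rewrite normrZ gtr0_norm ?invr_gt0// ler_pdivrMl//.
  rewrite (le_trans (ler_normD _ _))// mulr_natl mulr2n lerD//.
    exact: Cx.
  exact: Cy.
have [|u Cu Ku] := min_norm_fixed (S := K) C0 Cmid.
  by move=> g x Kg Cx h Kh; rewrite -repM; apply: Cx; exact: KM.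
exists u => //; apply/ler_addgt0Pl => e e0.
have [x [Cx]] := Cu _ (nbhsx_ballx u e e0); rewrite -ball_normE/= => ux.
rewrite -(subrK x u) -addrA (le_trans (ler_normD _ _))// lerD ?(ltW ux)//.
by rewrite -[x]rep1 Cx.
Qed.

Lemma fixed_closure (S : set G) u :
  (forall g, S g -> pi g u = u) -> forall g, closure S g -> pi g u = u.
Proof.
move=> Su g Sg.
have clo : closed ((fun h => pi h u) @^-1` [set u]).
  apply: closed_comp => [h _|]; first exact: rep_continuous.
  apply: (@accessible_closed_set1 V).
  exact: (hausdorff_accessible (@norm_hausdorff _ V)).
have Su' : S `<=` (fun h => pi h u) @^-1` [set u] by [].
exact: (clo g (closure_subset Su' Sg)).
Qed.

Lemma norm_realC r : `|r%:C| = `|r|%:C.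
Proof. by rewrite normc_def /= expr0n /= addr0 sqrtr_sqr. Qed.

Lemma norm_matrix_coef_continuous v w :
  continuous (fun g => complex.Re `|matrix_coef pi v w g| : R).
Proof.
move=> g; apply/cvgrPdist_lt => e e0.
have w0 : 0 < rnorm w + 1 by rewrite ltr_wpDl ?rnorm_ge0.
have : nbhs (pi g v) (ball (pi g v) (e / (rnorm w + 1))%:C).
  by apply: nbhsx_ballx; rewrite ltcR divr_gt0.
move=> /(@rep_continuous _ _ _ pi v g) near_g.
apply: (@filterS _ (nbhs g) _ _ _ _ near_g) => h /=.
rewrite -ball_normE /= rnormE ltcR ltr_pdivlMr// => hg.
pose c := matrix_coef pi v w.
rewrite -ltcR (@le_lt_trans _ _ `|c g - c h|)//.
  have := ler_dist_dist (c g) (c h).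
  rewrite -(RRe_real (normr_real (c g))) -(RRe_real (normr_real (c h))).
  by rewrite -rmorphB norm_realC.
rewrite /c /matrix_coef -linearBl /=.
rewrite (le_lt_trans (cauchy_schwarz _ _))// !rnormE -rmorphM ltcR.
by rewrite (le_lt_trans _ hg)// ler_wpM2l ?rnorm_ge0// lerDl.
Qed.

End Representation.

Lemma mulr_div_succ_lt (R : realFieldType) (x a : R) :
  (0 <= x -> 0 < a -> x * (a / (x + 1)) < a)%R.
Proof.
move=> x0 a0; have x1 : (0 < x + 1)%R by rewrite ltr_wpDl.
by rewrite mulrCA gtr_pMr// ltr_pdivrMr// mul1r ltrDl.
Qed.

Section Criterion.
Local Open Scope classical_set_scope.
Local Open Scope ring_scope.
Local Notation "r %:C" := (real_complex _ r).
Variables (R : realType) (G : topGroupType) (H : set G).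
Variables (K L E : nat -> set G).

(** A contraction criterion. The submonoids [K m] shrink to the identity,
    the increasing sets [L n] have a union whose closure contains [H], and
    each [L n] is conjugated into a given [K m] by all elements of [H]
    outside one of the sets [E k], which meet [H] in compact sets.

    Given vectors v and w, continuity provides a [K m]-fixed vector v' near
    v. For h in [H] outside [E k], the vector pi(h) v' is fixed by [L n],
    and so has the same inner product with w as with any vector z that the
    [L n]-fixed vectors do not tell apart from w. The set of those z, for
    all n together, is convex and invariant under the union of the [L n].
    The vector of minimal norm in its closure is therefore fixed by [H]; if
    [H] fixes no nonzero vector, then z can be chosen arbitrarily small. *)
Lemma howe_moore_criterion :
  (forall m, K m 1%g) ->
  (forall m g h, K m g -> K m h -> K m (g * h)%g) ->
  (forall U, nbhs (1%g : G) U -> exists m, K m `<=` U) ->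
  (forall m n, (m <= n)%N -> L m `<=` L n) ->
  H `<=` closure (\bigcup_n L n) ->
  (forall m n, exists k, forall h g, H h -> ~ E k h -> L n g ->
     K m (h^-1 * g * h)%g) ->
  (forall n, compact [set h : set_type H | E n (\val h)]) ->
  relative_howe_moore R H.
Proof.
move=> K1 KM Kbase Lmono Hcl conj Ecpt V pi _.
have [Hfix|/forall2NP Hfix] :=
  pselect (exists2 v : V, v != 0 & forall h, H h -> pi h v = v); first by left.
right=> v w e e0.
have nw0 : 0 < rnorm w + 1 by rewrite ltr_wpDl ?rnorm_ge0.
pose r := e / 2 / (rnorm w + 1).
have r0 : 0 < r by rewrite !divr_gt0.
have [m Km] : exists m, K m `<=` [set g | `|pi g v - v| < r%:C].
  apply: Kbase.
  have : nbhs (pi 1%g v) (ball (pi 1%g v) r%:C).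
    by apply: nbhsx_ballx; rewrite ltcR.
  move=> /(@rep_continuous _ _ _ pi v 1%g) near1.
  apply: (@filterS _ (nbhs (1%g : G)) _ _ _ _ near1) => h /=.
  by rewrite -ball_normE /= rep1 distrC.
have [v' v'v Kv'] := near_fixed_vector (K1 m) (KM m) Km.
have nv0 : 0 < rnorm v' + 1 by rewrite ltr_wpDl ?rnorm_ge0.
(* the vectors that, for some n, the L n-fixed vectors do not tell from w *)
pose C := [set z | exists n, forall x, (forall g, L n g -> pi g x = x) ->
  hdot V x z = hdot V x w].
have C0 : C !=set0 by exists w; exists 0%N.
have Cmid x y : C x -> C y -> C (2^-1 *: (x + y)).
  move=> [n1 C1] [n2 C2]; exists (maxn n1 n2) => z Lz.
  have L1 g : L n1 g -> pi g z = z by move=> /(Lmono _ _ (leq_maxl n1 n2))/Lz.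
  have L2 g : L n2 g -> pi g z = z by move=> /(Lmono _ _ (leq_maxr n1 n2))/Lz.
  rewrite linearZr_LR /= linearDr /= C1// C2//.
  by rewrite fmorphV rmorph_nat -mulr2n -(mulr_natl (hdot V z w)) mulKf.
have [|u Cu Lu] := min_norm_fixed (pi := pi) (S := \bigcup_n L n) C0 Cmid.
  move=> g z [n2 _ Lg] [n1 C1]; exists (maxn n1 n2) => x Lx.
  rewrite -[in LHS](Lx g) ?rep_hdot ?C1// => [h Lh|].
    by apply: Lx; exact: Lmono (leq_maxl n1 n2) _ Lh.
  exact: Lmono (leq_maxr n1 n2) _ Lg.
have u0 : u = 0.
  have [/negP|] := Hfix u; first by rewrite negbK => /eqP.
  by case=> h Hh; apply: (fixed_closure Lu); exact: Hcl.
pose s := e / 2 / (rnorm v' + 1).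
have s0 : 0 < s by rewrite !divr_gt0.
have [z [[n Cz] zs]] : (C `&` ball u s%:C) !=set0.
  by apply: Cu; apply: nbhsx_ballx; rewrite ltcR.
have {}zs : rnorm z < s.
  by move: zs; rewrite -ball_normE /= u0 sub0r normrN rnormE ltcR.
have [k kconj] := conj m n.
apply: subclosed_compact (Ecpt k) _ => [|h /=].
  rewrite (_ : mkset _ = (fun h : set_type H =>
      complex.Re `|matrix_coef pi v w (\val h)|) @^-1` [set x : R | e <= x]).
    apply: closed_comp => [h _|]; last exact: closed_ge.
    apply: (@continuous_comp _ G _ (\val : set_type H -> G)
      (fun g => complex.Re `|matrix_coef pi v w g|)).
      exact: initial_continuous.
    exact: norm_matrix_coef_continuous.
  by apply/seteqP; split=> h /=;
    rewrite -(RRe_real (normr_real (matrix_coef pi v w (\val h)))) lecR.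
apply: contraPP => nEh; apply/negP; rewrite -real_ltNge ?realE ?normr_ge0//.
set g := \val h.
have Hh : H g by exact: (set_mem (valP h)).
have v'z : hdot V (pi g v') z = hdot V (pi g v') w.
  apply: Cz => l Ll; rewrite -repM.
  by rewrite -[in RHS](Kv' _ (kconj _ _ Hh nEh Ll)) -repM !mulgA mulgV mul1g.
have -> : matrix_coef pi v w g =
    hdot V (pi g v') z - hdot V (pi g (v' - v)) w.
  rewrite v'z /matrix_coef repB; move: (pi g v) (pi g v') => a b.
  by rewrite linearBl /= subKr.
rewrite (le_lt_trans (ler_normB _ _))// (splitr e) rmorphD ltr_leD//.
- rewrite (le_lt_trans (cauchy_schwarz _ _))// rep_norm !rnormE -rmorphM ltcR.
  rewrite (@le_lt_trans _ _ (rnorm v' * s))//.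
    by rewrite ler_wpM2l ?rnorm_ge0 ?ltW.
  by rewrite mulr_div_succ_lt ?rnorm_ge0 ?divr_gt0.
- rewrite (le_trans (cauchy_schwarz _ _))// rep_norm.
  rewrite (le_trans (ler_wpM2r _ v'v))// rnormE -rmorphM lecR mulrC.
  by rewrite ltW// mulr_div_succ_lt ?rnorm_ge0 ?divr_gt0.
- by rewrite ler0c ltW.
Qed.

End Criterion.

(** * Rays and ends in a tree *)

Section Tree.
Local Open Scope classical_set_scope.
Variables (d : nat) (T : regularTree d).
Implicit Types (x y z : T) (r s t w : nat -> T).

Lemma path_map_iota w m n :
  (forall i, m <= i < m + n -> adj T (w i) (w i.+1)) ->
  path (adj T) (w m) [seq w i | i <- iota m.+1 n].
Proof.
elim: n m => //= n IHn m wadj; rewrite wadj ?IHn//=; last first.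
  by rewrite leqnn -addSnnS leq_addr.
by move=> i /andP[mi im]; rewrite wadj// ltnW//= -addSnnS.
Qed.

(** A walk without backtracking in a tree never meets itself: between two
    closest visits of the same vertex it would run through a circuit. *)
Lemma walk_inj w n : (forall i, i < n -> adj T (w i) (w i.+1)) ->
  (forall i, i.+1 < n -> w i <> w i.+2) -> forall i j, i < j <= n -> w i <> w j.
Proof.
move=> wadj wback i j /andP[/subnKC <-]; move: (j - i.+1) => l {j}.
elim/ltn_ind: l i => l IHl i; rewrite addSnnS => ln wij.
have cyc : path.cycle (adj T) [seq w k | k <- iota i l.+1].
  rewrite /= (_ : rcons _ _ = [seq w k | k <- iota i.+1 l.+1]).
    by apply: path_map_iota => k /andP[_ /leq_trans/(_ ln)/wadj].
  by rewrite wij -[in RHS](addn1 l) iotaD map_cat cats1 addSnnS.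
have uni : uniq [seq w k | k <- iota i l.+1].
  rewrite map_inj_in_uniq ?iota_uniq// => a b.
  rewrite !mem_iota.
  wlog ab : a b / a < b => [wlog_ab ai bi wab|/andP[ia ai] /andP[ib bi] wab].
    have [/wlog_ab|/wlog_ab|//] := ltngtP a b; first exact.
    by move=> ba; apply/esym/ba.
  exfalso; apply: (IHl (b - a.+1) _ a); rewrite ?subnKC//; last first.
    by rewrite (leq_trans _ ln)// ltnW.
  rewrite ltn_subLR//; apply: leq_trans bi _.
  by rewrite addnS addSn ltnS leq_add2r.
have := tree_acyclic uni cyc; rewrite size_map size_iota.
case: l {IHl uni cyc} ln wij => [|[|//]] ln wij _.
  by rewrite addn1 in ln wij; have := wadj _ ln; rewrite -wij adj_irr.
by rewrite addn2 in ln wij; exact: wback ln wij.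
Qed.

Lemma cofinal_sym r s : cofinal_rays r s -> cofinal_rays s r.
Proof. by move=> [m [n rs]]; exists n, m. Qed.

Lemma cofinal_trans r s t :
  cofinal_rays r s -> cofinal_rays s t -> cofinal_rays r t.
Proof.
move=> [m [n rs]] [m' [n' st]]; exists (m + m'), (n' + n) => k.
by rewrite -!addnA rs -st addnCA.
Qed.

Lemma shift_ray r : ray r -> ray (fun n => r n.+1).
Proof. by move=> [radj rinj]; split=> // m n /rinj []. Qed.

Lemma shift_cofinal r : cofinal_rays r (fun n => r n.+1).
Proof. by exists 1, 0. Qed.

(** The sequence [r] preceded by the vertex [z]. *)
Definition cons_ray z r : nat -> T := fun n => if n is n'.+1 then r n' else z.

Lemma cons_rayP z r : ray r -> adj T z (r 0) -> z <> r 1 -> ray (cons_ray z r).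
Proof.
move=> [radj rinj] zr zr1; split=> [[|n]//=|].
suff W i j : i < j -> cons_ray z r i <> cons_ray z r j.
  move=> i j; have [ij /(W _ _ ij)//|ji /esym/(W _ _ ji)//|//] := ltngtP i j.
move=> ij; apply: (@walk_inj _ j) => [[|k] _ //=|[|k]//= _ /rinj /eqP|].
  by rewrite ltn_eqF.
by rewrite ij leqnn.
Qed.

(** Two cofinal rays from the same vertex take the same first step:
    otherwise following one of them backwards and then the other would give
    a walk without backtracking that meets itself. *)
Lemma cofinal_ray_uniq r s : ray r -> ray s -> cofinal_rays r s ->
  r 0 = s 0 -> r 1 = s 1.
Proof.
move=> [radj rinj] [sadj sinj] [m [n rs]] rs0; apply: contrapT => rs1.
have [mn0|mn0] := posnP (m + n).
  move: mn0 rs => /eqP; rewrite addn_eq0 => /andP[/eqP-> /eqP->] /(_ 1).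
  exact: rs1.
(* r backwards from r m to the common origin, then s up to s n = r m *)
pose w i := if i <= m then r (m - i) else s (i - m).
have wr i : i <= m -> w i = r (m - i) by rewrite /w => ->.
have ws i : m <= i -> w i = s (i - m).
  by rewrite leq_eqVlt /w => /predU1P[<-|mi]; rewrite ?leqnn ?subnn// leqNgt mi.
have := rs 0; rewrite !addn0 => rsmn.
apply: (@walk_inj w (m + n) _ _ 0 (m + n)) => [i imn|i imn||].
- have [im|mi] := ltnP i m.
    by rewrite !wr// 1?ltnW// -(subnSK im) adj_sym.
  by rewrite !ws ?(leq_trans mi)// subSn.
- have [im|mi] := ltnP i.+1 m.
    rewrite !wr// 1?ltnW 1?ltnW// => /rinj/eqP.
    by rewrite -(subnSK (ltnW im)) -(subnSK im) gtn_eqF// ltnW.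
  have [{}mi|im] := leqP m i.
    have mi2 := leqW (leqW mi).
    rewrite !ws// => /sinj/eqP; rewrite !subSn// 1?leqW//.
    by rewrite ltn_eqF// ltnS leqnSn.
  have {im}mi : m = i.+1 by apply/eqP; rewrite eqn_leq mi im.
  by rewrite (ws i.+2) ?(wr i) ?mi ?leqnSn// subSnn subSnn.
- by rewrite mn0 leqnn.
- by rewrite wr// ws ?leq_addr// subn0 addKn.
Qed.

Variable xi : set (nat -> T).
Hypothesis xi_end : ends xi.

Lemma end_ray r : xi r -> ray r.
Proof. by case: xi_end => r0 _ -> []. Qed.

Lemma end_cofinal r s : xi r -> xi s -> cofinal_rays r s.
Proof.
case: xi_end => r0 _ -> [_ rr] [_ rs].
exact: cofinal_trans (cofinal_sym rr) rs.
Qed.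

Lemma cofinal_end r s : xi r -> ray s -> cofinal_rays r s -> xi s.
Proof.
case: xi_end => r0 _ -> [_ rr] ss rs; split=> //.
exact: cofinal_trans rr rs.
Qed.

Lemma end_shift r : xi r -> xi (fun n => r n.+1).
Proof.
move=> xr; apply: (cofinal_end xr); last exact: shift_cofinal.
exact/shift_ray/end_ray.
Qed.

Lemma end_cons z r : xi r -> adj T z (r 0) -> z <> r 1 -> xi (cons_ray z r).
Proof.
move=> xr zr zr1; apply: (cofinal_end xr); last first.
  exact: cofinal_sym (shift_cofinal _).
by apply: cons_rayP => //; exact: end_ray.
Qed.

Lemma ray_from y : exists2 r, xi r & r 0 = y.
Proof.
have [r0 xr0] : exists r, xi r.
  by case: xi_end => r rr ->; exists r; split=> //; exists 0, 0.
have [p] := tree_connected (r0 0) y.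
elim: p r0 xr0 => [r0 xr0 _ <-|z p IHp r0 xr0 /= /andP[r0z zp] yp].
  by exists r0.
have [zr1|zr1] := pselect (z = r0 1).
  by apply: (IHp _ (end_shift xr0)); rewrite -?zr1.
apply: (IHp (cons_ray z r0)) => //.
by apply: end_cons => //; rewrite adj_sym.
Qed.

(** An end orients the tree: the parent of a vertex is the next vertex on
    the ray that leads from it to the end. The end is recovered as the set
    of all orbits of the parent map. *)
Lemma end_parent : exists p : T -> T,
  [/\ forall x y, adj T x y <-> p x = y \/ p y = x,
      forall x y, exists m n, iter m p x = iter n p y,
      forall n x, iter n p x = x -> n = 0
    & xi = [set r | forall n, r n.+1 = p (r n)]].
Proof.
have [/= ray_at xi_at ray_at0] :
    {f : T -> nat -> T | (forall y, xi (f y)) & forall y, f y 0 = y}.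
  exists (fun y => projT1 (cid2 (ray_from y))) => y; by case: cid2.
pose p y := ray_at y 1.
have xi_p r : xi r -> forall n, r n.+1 = p (r n).
  move=> + n; elim: n r => [|n IHn] r xr; last exact: IHn _ (end_shift xr).
  have xr0 := xi_at (r 0).
  apply: cofinal_ray_uniq; [exact: end_ray|exact: end_ray| |by rewrite ray_at0].
  exact: end_cofinal.
have iter_p y n : iter n p y = ray_at y n.
  by elim: n => [|n IHn]; rewrite ?ray_at0//= IHn (xi_p _ (xi_at y)).
have adj_p x : adj T x (p x).
  by have [/(_ 0)] := end_ray (xi_at x); rewrite ray_at0.
exists p; split.
- move=> x y; split=> [xy|[<-//|<-]]; last by rewrite adj_sym.
  have [<-|yp] := pselect (p x = y); first by left.
  right.
  have xc : xi (cons_ray y (ray_at x)).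
    by apply: end_cons; rewrite ?ray_at0 1?adj_sym// => /esym.
  by have := xi_p _ xc 0; rewrite /= ray_at0 => <-.
- move=> x y; have [m [n /(_ 0)]] := end_cofinal (xi_at x) (xi_at y).
  by rewrite !addn0 -!iter_p => xy; exists m, n.
- move=> n x; rewrite iter_p -{2}(ray_at0 x).
  by have [_ inj] := end_ray (xi_at x) => /inj.
- apply/seteqP; split=> r /= => [xr|rp]; first exact: xi_p.
  rewrite (_ : r = ray_at (r 0))//; apply/funext => n; rewrite -iter_p.
  by elim: n => //= n <-.
Qed.

End Tree.

(** * Topological and group-theoretic preliminaries *)

Section Topology.
Local Open Scope classical_set_scope.

Lemma cvg_set_type (X : topologicalType) (A : set X)
    (F : set_system (set_type A)) (x : set_type A) : Filter F ->
  (\val y @[y --> F] : set_system X) --> (\val x : X) -> F --> x.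
Proof.
move=> FF Fx U; case=> _ [[W oW <-] Wx] /filterS; apply.
by apply: Fx; exact: open_nbhs_nbhs.
Qed.

(** A function into a finite set is constant along an ultrafilter. *)
Lemma ultra_pigeonhole (X : Type) (Y : choiceType) (F : set_system X)
    (f : X -> Y) (B : set Y) : UltraFilter F -> finite_set B ->
  F (f @^-1` B) -> exists2 b, B b & F (f @^-1` [set b]).
Proof.
move=> UF /finite_seqP[s ->] {B}; elim: s => [|a s IHs] Fs.
  by have [x] := filter_ex Fs; rewrite /= in_nil.
have [Fa|Fa] := in_ultra_setVsetC (f @^-1` [set a]) UF.
  by exists a => //=; rewrite mem_head.
have [|b /= bs Fb] := IHs.
  by apply: filterS2 Fs Fa => x /=; rewrite in_cons => /orP[/eqP|//].
by exists b => //=; rewrite in_cons bs orbT.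
Qed.

End Topology.

Section Groups.
Local Open Scope classical_set_scope.

Lemma group_closed_mul (X : groupType) (A : set X) (x y : X) :
  group_closed [in A] -> A x -> A y -> A (x * y)%g.
Proof.
move=> Agrp Ax Ay; apply/set_mem.
by apply: (group_closedM Agrp); exact: mem_set.
Qed.

Lemma group_closed_inv (X : groupType) (A : set X) (x : X) :
  group_closed [in A] -> A x -> A (x^-1)%g.
Proof.
by move=> Agrp Ax; apply/set_mem; apply: (group_closedV Agrp); exact: mem_set.
Qed.

End Groups.

(** * The groups U(F) and U(F)^+ *)

Section UniversalGroup.
Local Open Scope classical_set_scope.
Variables (d : nat) (T : regularTree d) (iota : set T -> 'I_d).
Variable F : {group 'S_d}.
Implicit Types (x y z a : T) (g h : aut T).
Local Notation U := (universal_group iota F).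
Local Notation G := (universal_group_plus iota F).

Lemma aut_mulE g h x : (g * h)%g x = g (h x). Proof. by []. Qed.
Lemma autKV g x : g (g^-1%g x) = x. Proof. exact: aut_invK. Qed.
Lemma autVK g x : g^-1%g (g x) = x. Proof. exact: aut_funK. Qed.

Lemma starP x e : star x e <-> exists2 y, adj T x y & e = [set x; y].
Proof.
split=> [[[y [z [yz ->]]] [->|->]]|[y xy ->]].
- by exists z.
- by exists y; rewrite 1?adj_sym// setUC.
- by split; [exists x, y|left].
Qed.

(** The local permutation of colors that [g] induces at [x] belongs to [F].
    In contrast with the definition of the universal group, edges at [x] are
    given here by their other endpoint. *)
Definition acts_locally_in g x : Prop := exists2 s : 'S_d, s \in F &
  forall y, adj T x y -> s (iota [set x; y]) = iota [set g x; g y].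

Lemma universal_groupP g : U g <-> forall x, acts_locally_in g x.
Proof.
split=> Ug x; have [s sF sP] := Ug x; exists s => //.
  move=> y xy; rewrite sP ?image_setU ?image_set1//.
  by apply/starP; exists y.
by move=> e /starP[y xy ->]; rewrite sP// image_setU !image_set1.
Qed.

Lemma universal_group_closed : group_closed [in U].
Proof.
split=> [|g h]; rewrite !inE.
  by apply/universal_groupP => x; exists 1%g => // y _; rewrite perm1.
move=> /universal_groupP Ug /universal_groupP Uh; apply/universal_groupP => x.
have [s sF sP] := Ug (h^-1%g x); have [t tF tP] := Uh (h^-1%g x).
exists (t^-1 * s)%g; first by rewrite groupM ?groupV.
move=> y xy; have hxy : adj T (h^-1%g x) (h^-1%g y) by rewrite aut_adj.
rewrite permM !aut_mulE -sP//; congr (s _).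
by rewrite -[x in LHS](autKV h) -[y in LHS](autKV h) -tP// permK.
Qed.

Lemma universal_group_plus_sub : (G : set (aut T)) `<=` U.
Proof.
by apply: smallest_sub; [exact: universal_group_closed|move=> g []].
Qed.

Lemma universal_group_plusP x y g : adj T x y -> U g -> g x = x -> g y = y ->
  (G : set (aut T)) g.
Proof.
move=> xy Ug gx gy; apply: sub_gen_smallest; split=> //.
by exists [set x; y] => [|z [->|->]//]; exists x, y.
Qed.

(** Membership in U(F)^+ of an element of U(F) is decided by its restriction
    to a single edge; in particular U(F)^+ is open in U(F). *)
Lemma universal_group_plus_near g h x y : adj T x y -> (G : set (aut T)) h ->
  U g -> g x = h x -> g y = h y -> (G : set (aut T)) g.
Proof.
move=> xy Gh Ug gx gy.
have GP := subgroup_closed G; have UP := universal_group_closed.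
have : (G : set (aut T)) (h * (h^-1 * g))%g.
  apply: (@group_closed_mul _ G) => //.
  apply: (universal_group_plusP xy); rewrite ?aut_mulE ?gx ?gy ?autVK//.
  apply: (@group_closed_mul _ U) => //; apply: (@group_closed_inv _ U) => //.
  exact: universal_group_plus_sub.
by rewrite mulgA mulgV mul1g.
Qed.

(* the parent map of an end *)
Variables (p : T -> T).
Hypothesis adj_parent : forall x y, adj T x y <-> p x = y \/ p y = x.
Hypothesis parent_meet : forall x y, exists m n, iter m p x = iter n p y.
Hypothesis parent_acyclic : forall n x, iter n p x = x -> n = 0.

(** Commuting with the parent map amounts to fixing the end. *)
Definition commutes g : Prop := forall x, g (p x) = p (g x).

Lemma commutesV g : commutes g -> commutes g^-1%g.
Proof. by move=> gp x; rewrite -{1}(autKV g x) -gp autVK. Qed.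

Lemma commutes_iter g n x : commutes g -> g (iter n p x) = iter n p (g x).
Proof. by move=> gp; elim: n => //= n <-. Qed.

(** The vertices from which the way to the end leads through [a], including
    [a]; they form the half-tree behind [a]. *)
Definition below a y := exists k, iter k p y = a.

Lemma below_step a x : below a x -> x = a \/ below a (p x).
Proof. by case=> [[|k]] xk; [left|right; exists k; rewrite -iterSr]. Qed.

Lemma below_parent a x : below a (p x) -> below a x.
Proof. by case=> k xk; exists k.+1; rewrite iterSr. Qed.

Lemma parent_not_below a k : ~ below a (iter k.+1 p a).
Proof. by case=> m; rewrite -iterD addnS => /parent_acyclic. Qed.

Lemma below_aut g a x : commutes g -> g a = a -> below a x -> below a (g x).
Proof. by move=> gp ga [k xk]; exists k; rewrite -commutes_iter// xk. Qed.

(** The map that agrees with [f] on the half-tree behind [a] and is the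
    identity elsewhere. *)
Definition cutoff a (f : T -> T) y : T := if `[< below a y >] then f y else y.

Lemma cutoff_below a f y : below a y -> cutoff a f y = f y.
Proof. by rewrite /cutoff; case: asboolP. Qed.

Lemma cutoff_not_below a f y : ~ below a y -> cutoff a f y = y.
Proof. by rewrite /cutoff; case: asboolP. Qed.

Section Cutoff.
Variables (g : aut T) (a : T).
Hypotheses (gp : commutes g) (ga : g a = a).

(** The only edge leaving the half-tree joins [a] to its parent, and [g] fixes
    both. *)
Lemma cutoff_adj_below x y : below a x -> adj T x y -> cutoff a g y = g y.
Proof.
move=> ax /adj_parent xy; have [/cutoff_below//|ay] := pselect (below a y).
rewrite cutoff_not_below//; case: xy => [xy|yx]; last first.
  by case: ay; apply: below_parent; rewrite yx.
have [xa|] := below_step ax; last by rewrite xy.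
by rewrite -xy gp xa ga.
Qed.

Lemma cutoff_adj_not_below x y : ~ below a x -> adj T x y -> cutoff a g y = y.
Proof.
move=> ax /adj_parent xy; have [ay|/cutoff_not_below//] := pselect (below a y).
rewrite cutoff_below//; case: xy => [xy|yx].
  by case: ax; apply: below_parent; rewrite xy.
by have [-> //|] := below_step ay; rewrite yx.
Qed.

Lemma cutoff_adj x y : adj T x y -> adj T (cutoff a g x) (cutoff a g y).
Proof.
move=> xy; have [ax|ax] := pselect (below a x).
  by rewrite (cutoff_below _ ax) (cutoff_adj_below ax xy) aut_adj.
by rewrite (cutoff_not_below _ ax) (cutoff_adj_not_below ax xy).
Qed.

End Cutoff.

Lemma cutoffK g a : commutes g -> g a = a ->
  cancel (cutoff a g) (cutoff a g^-1%g).
Proof.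
move=> gp ga x; have [ax|ax] := pselect (below a x); last first.
  by rewrite !cutoff_not_below.
by rewrite (cutoff_below _ ax) cutoff_below ?autVK//; exact: below_aut.
Qed.

Lemma cutoff_aut g a :
  commutes g -> g a = a -> exists h : aut T, h =1 cutoff a g.
Proof.
move=> gp ga; have gVp := commutesV gp.
have gVa : g^-1%g a = a by rewrite -{1}ga autVK.
have K := cutoffK gp ga.
have VK : cancel (cutoff a g^-1%g) (cutoff a g).
  by have := cutoffK gVp gVa; rewrite invgK.
suff madj : {mono cutoff a g : x y / adj T x y} by exists (Aut K VK madj).
move=> x y; apply/idP/idP => [xy|]; last exact: cutoff_adj.
by rewrite -(K x) -(K y); apply: cutoff_adj.
Qed.

(** Tits' independence property: the cutoff of an element of U(F) that fixes
    the end and the vertex [a] belongs to U(F), since at each vertex it acts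
    either as that element or as the identity; and it fixes the edge between
    the parent and the grandparent of [a]. *)
Lemma universal_group_independence g a : U g -> commutes g -> g a = a ->
  exists2 h : aut T, (G : set (aut T)) h & h =1 cutoff a g.
Proof.
move=> /universal_groupP Ug gp ga; have [h hE] := cutoff_aut gp ga.
exists h => //; have nb k := @parent_not_below a k.
apply: (@universal_group_plusP (p a) (p (p a))).
- by apply/adj_parent; left.
- apply/universal_groupP => x; have [ax|ax] := pselect (below a x).
    have [s sF sP] := Ug x; exists s => // y xy.
    by rewrite sP// !hE (cutoff_below _ ax) (cutoff_adj_below gp ga ax xy).
  exists 1%g => // y xy.
  by rewrite perm1 !hE (cutoff_not_below _ ax) (cutoff_adj_not_below ga ax xy).
- by rewrite hE cutoff_not_below//; exact: (nb 0).
- by rewrite hE cutoff_not_below//; exact: (nb 1).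
Qed.

Lemma finite_descendants n a : finite_set [set x | iter n p x = a].
Proof.
elim: n => [|n IHn] /=; first exact: finite_set1.
rewrite (_ : mkset _ =
    \bigcup_(y in [set x | iter n p x = a]) [set x | p x = y]).
  apply: bigcup_finite => // y _.
  apply: (@sub_finite_set _ _ [set x | adj T y x]) => [x yx|].
    by apply/adj_parent; right.
  by exists d; exact: tree_regular.
apply/seteqP; split=> x /=; rewrite -iterS iterSr; first by exists (p x).
by case=> y ya ->.
Qed.

End UniversalGroup.

(** * Pointwise limits of automorphisms *)

Section Limits.
Local Open Scope classical_set_scope.
Variables (d : nat) (T : regularTree d) (iota : set T -> 'I_d).
Variable F : {group 'S_d}.
Variables (X : Type) (u : set_system X) (f : X -> aut T).
Hypothesis u_ultra : UltraFilter u.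

(** Automorphisms whose orbits stay finite along an ultrafilter, as do those
    of their inverses, converge pointwise to an automorphism. *)
Lemma ultra_aut_limit :
  (forall x, exists2 B, finite_set B & u [set h | B (f h x)]) ->
  (forall x, exists2 B, finite_set B & u [set h | B ((f h)^-1%g x)]) ->
  exists g : aut T, forall x, u [set h | f h x = g x].
Proof.
move=> fin finV.
have /choice[g gP] x : exists y, u [set h | f h x = y].
  by have [B Bfin /(ultra_pigeonhole u_ultra Bfin)[y _]] := fin x; exists y.
have /choice[gV gVP] x : exists y, u [set h | (f h)^-1%g x = y].
  by have [B Bfin /(ultra_pigeonhole u_ultra Bfin)[y _]] := finV x; exists y.
have gK : cancel g gV.
  move=> x; have [h [/= hx <-]] := filter_ex (filterI (gP x) (gVP (g x))).
  by rewrite -hx aut_funK.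
have gVK : cancel gV g.
  move=> x; have [h [/= hx <-]] := filter_ex (filterI (gVP x) (gP (gV x))).
  by rewrite -hx aut_invK.
have gadj : {mono g : x y / adj T x y}.
  move=> x y; have [h [/= <- <-]] := filter_ex (filterI (gP x) (gP y)).
  by rewrite aut_adj.
by exists (Aut gK gVK gadj).
Qed.

Lemma universal_group_limit (g : aut T) :
  u [set h | universal_group iota F (f h)] ->
  (forall x, u [set h | f h x = g x]) -> universal_group iota F g.
Proof.
move=> uU ug; apply/universal_groupP => x.
pose P h (s : 'S_d) := s \in F /\
  forall y, adj T x y -> s (iota [set x; y]) = iota [set f h x; f h y].
have [s sP] : exists s, u [set h | P h s].
  have /choice[S SP] h : exists s, universal_group iota F (f h) -> P h s.
    have [Uf|?] := pselect (universal_group iota F (f h)); last by exists 1%g.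
    by have [s sF sP] := (universal_groupP _ _ _).1 Uf x; exists s.
  (* the symmetric group is finite *)
  have [|s _ us] := ultra_pigeonhole (f := S) (B := setT) u_ultra finite_finset.
    exact: filterT.
  by exists s; apply: filterS2 us uU => h /= <- /SP.
have [h [sF _]] := filter_ex sP.
exists s => // y xy.
have [{sF}h [[[_ hs] /= <-] <-]] :=
  filter_ex (filterI (filterI sP (ug x)) (ug y)).
exact: hs.
Qed.

End Limits.

(** * The elliptic stabilizer of an end *)

Section EndStabilizer.
Local Open Scope classical_set_scope.
Variables (d : nat) (T : regularTree d) (iota : set T -> 'I_d).
Variable F : {group 'S_d}.
(* the parent map of the end xi below, and the ray to xi from a base vertex *)
Variables (p : T -> T).
Hypothesis adj_parent : forall x y, adj T x y <-> p x = y \/ p y = x.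
Hypothesis parent_meet : forall x y, exists m n, iter m p x = iter n p y.
Hypothesis parent_acyclic : forall n x, iter n p x = x -> n = 0.
Variable x0 : T.
Local Notation G := (universal_group_plus iota F).
Local Notation xi := [set r : nat -> T | forall n, r n.+1 = p (r n)].
Local Notation H := (elliptic_end_stabilizer (G := G) xi).
Local Notation "''x_' n" := (iter n p x0) (at level 8, n at level 2).

Lemma aut_end_commutes (g : aut T) : aut_end g xi = xi <-> commutes p g.
Proof.
split=> [gxi x|gp].
  pose r n := iter n p x; have : aut_end g xi (g \o r) by exists r.
  by rewrite gxi => /(_ 0).
apply/seteqP; split=> [_ [r rp <-] n|r rp] /=; first by rewrite rp gp.
exists (g^-1%g \o r) => [n|].
  by rewrite -[LHS]/(g^-1%g (r n.+1)) rp (commutesV gp).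
by apply/funext => n /=; rewrite aut_invK.
Qed.

Lemma fix_mono (g : aut T) m n : commutes p g -> m <= n ->
  g 'x_m = 'x_m -> g 'x_n = 'x_n.
Proof.
by move=> gp /subnK <- gm; rewrite iterD commutes_iter// gm.
Qed.

Lemma elliptic_end_stabilizerP (g : set_type G) :
  H g <-> commutes p (\val g) /\ exists n, (\val g : aut T) 'x_n = 'x_n.
Proof.
split=> [[/aut_end_commutes gp [y gy]]|[/aut_end_commutes gp [n gn]]].
  split=> //; have [m [n mn]] := parent_meet y x0.
  by exists n; rewrite -mn commutes_iter// gy.
by split=> //; exists 'x_n.
Qed.

Lemma near_aut (g : set_type G) x :
  nbhs g [set h : set_type G | (\val h : aut T) x = (\val g : aut T) x].
Proof.
have : nbhs (\val g : aut T) [set h : aut T | h x = (\val g : aut T) x].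
  by move: x; apply/aut_cvgP; exact: cvg_id.
exact: (@initial_continuous _ _ (\val : set_type G -> aut T) g).
Qed.

Lemma cvg_set_type_aut (W : set_system (set_type G)) (g : set_type G) :
  Filter W ->
  (forall x, W [set h | (\val h : aut T) x = (\val g : aut T) x]) -> W --> g.
Proof.
by move=> WF Wg; apply: cvg_set_type; apply/aut_cvgP.
Qed.

Lemma elliptic_end_stabilizer_group : group_closed [in H].
Proof.
split=> [|g h]; rewrite !inE.
  by apply/elliptic_end_stabilizerP; split=> //; exists 0.
move=> /elliptic_end_stabilizerP[gp [m gm]].
move=> /elliptic_end_stabilizerP[hp [n hn]].
have hVp := commutesV hp; apply/elliptic_end_stabilizerP; split=> [x|].
  by rewrite -[\val _]/(\val g * (\val h)^-1)%g !aut_mulE hVp gp.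
exists (maxn m n); rewrite -[\val _]/(\val g * (\val h)^-1)%g !aut_mulE.
rewrite -{1}(fix_mono hp (leq_maxr m n) hn) autVK.
exact: fix_mono (leq_maxl m n) gm.
Qed.

Lemma elliptic_end_stabilizer_closed : closed H.
Proof.
move=> g Hg.
have gp : commutes p (\val g).
  move=> x; have [h [/elliptic_end_stabilizerP[hp _] [/= <- <-]]] :=
    Hg _ (filterI (near_aut g x) (near_aut g (p x))).
  exact: hp.
have [h [/elliptic_end_stabilizerP[hp [n hn]] /= h0]] := Hg _ (near_aut g x0).
apply/elliptic_end_stabilizerP; split=> //; exists n.
by rewrite commutes_iter// -h0 -commutes_iter.
Qed.

(** The elements that fix the n-th vertex of the ray. The group [H] is the
    increasing union of its intersections with these sets. *)
Definition fixer n : set (set_type G) := [set g | (\val g : aut T) 'x_n = 'x_n].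

(** An element of [H] that fixes the n-th vertex permutes the finitely many
    vertices that reach a later vertex of the ray in a given number of
    steps; hence all orbits are finite, and limits along ultrafilters exist. *)
Lemma fixer_compact n : compact [set h : set_type H | fixer n (\val h)].
Proof.
rewrite compact_ultra => u u_ultra un.
pose f (h : set_type H) : aut T := \val (\val h).
have fG h : (G : set (aut T)) (f h) by exact: (set_mem (valP (\val h))).
have fp h : commutes p (f h).
  by have /elliptic_end_stabilizerP[] : H (\val h) by exact: (set_mem (valP h)).
have orbit x : exists2 B, finite_set B &
    forall g, commutes p g -> g 'x_n = 'x_n -> B (g x).
  have [k [l xkl]] := parent_meet x 'x_n.
  exists [set y | iter k p y = 'x_(l + n)] => [|g gp gn /=].
    exact: (finite_descendants adj_parent).
  rewrite -commutes_iter// xkl -iterD.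
  by apply: fix_mono gn => //; exact: leq_addl.
have [|x|g gP] := ultra_aut_limit (f := f) u_ultra.
- move=> x; have [B Bfin BP] := orbit x; exists B => //.
  by apply: filterS un => h hn; exact: (BP _ (fp h) hn).
- have [B Bfin BP] := orbit x; exists B => //.
  apply: filterS un => h hn; apply: (BP (f h)^-1%g (commutesV (fp h))).
  have {}hn : f h 'x_n = 'x_n := hn.
  by rewrite -[RHS](autVK (f h)) hn.
have Ug : universal_group iota F g.
  apply: (universal_group_limit u_ultra _ gP); apply: filterE => h.
  exact: (universal_group_plus_sub (fG h)).
have Gg : (G : set (aut T)) g.
  have [h [/= h0 h1]] := filter_ex (filterI (gP x0) (gP (p x0))).
  by apply: (@universal_group_plus_near _ _ _ _ g (f h) x0 (p x0)) => //;
    apply/adj_parent; left.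
have gn : g 'x_n = 'x_n.
  by have [h [/= <-]] := filter_ex (filterI (gP 'x_n) un).
have gp : commutes p g.
  move=> x; have [h [/= <- <-]] := filter_ex (filterI (gP x) (gP (p x))).
  exact: fp.
pose g1 : set_type G := SigSub (mem_set Gg).
have Hg : H g1 by apply/elliptic_end_stabilizerP; split=> //; exists n.
exists (SigSub (mem_set Hg) : set_type H); split=> //=.
apply: cvg_set_type; apply: cvg_set_type_aut => x; exact: gP.
Qed.

(** The elements that act trivially on the half-tree behind the n-th vertex
    of the ray. *)
Definition branch_fixer n : set (set_type G) :=
  [set g | forall x, below p 'x_n x -> (\val g : aut T) x = x].

(** The elements that act trivially outside the half-tree behind the n-th
    vertex of the ray. *)
Definition branch_supported n : set (set_type G) :=
  [set g | forall x, ~ below p 'x_n x -> (\val g : aut T) x = x].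

Lemma below_mono m n x : m <= n -> below p 'x_m x -> below p 'x_n x.
Proof. by move=> /subnK <- [k xk]; exists (n - m + k); rewrite !iterD xk. Qed.

Lemma below_eventually x : exists n, below p 'x_n x.
Proof. by have [m [n mn]] := parent_meet x x0; exists n, m. Qed.

(** The half-trees behind the vertices of the ray exhaust the tree, so that
    their pointwise stabilizers shrink to the identity. *)
Lemma branch_fixer_base (U : set (set_type G)) :
  nbhs (1%g : set_type G) U -> exists m, branch_fixer m `<=` U.
Proof.
pose W := filter_from setT branch_fixer.
have WF : Filter W.
  apply: filter_from_filter => [|i j _ _]; first by exists 0.
  exists (maxn i j) => // g gfix.
  by split=> x bx; apply: gfix; apply: below_mono bx;
    rewrite ?leq_maxl ?leq_maxr.
suff W1 : W --> (1%g : set_type G) by move=> /W1[m _ mU]; exists m.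
apply: cvg_set_type_aut => x; have [n xn] := below_eventually x.
by exists n => // g; apply.
Qed.

(** An element of [H] is the limit of its cutoffs. *)
Lemma branch_supported_dense : H `<=` closure (\bigcup_n branch_supported n).
Proof.
move=> h /elliptic_end_stabilizerP[hp [N hN]] U hU.
have Uh : universal_group iota F (\val h).
  exact: (universal_group_plus_sub (set_mem (valP h))).
have /choice[k kP] n : exists k : set_type G,
    (\val k : aut T) =1 cutoff p 'x_(n + N) (\val h).
  have := @universal_group_independence _ _ iota F p adj_parent parent_acyclic
    (\val h) 'x_(n + N) Uh hp (fix_mono hp (leq_addl n N) hN).
  by move=> [k Gk kE]; exists (SigSub (mem_set Gk)).
have : k @ \oo --> h.
  apply: cvg_set_type_aut => x; have [n xn] := below_eventually x.
  exists n => // i /= ni; rewrite kP cutoff_below//.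
  by apply: below_mono xn; rewrite (leq_trans ni)// leq_addr.
move=> /(_ _ hU) [n _ /(_ n)] /= Uk.
exists (k n); split; last by apply: Uk; rewrite /= leqnn.
by exists (n + N) => // x nx; rewrite kP cutoff_not_below.
Qed.

Lemma iter_parent_inj x m n : iter m p x = iter n p x -> m = n.
Proof.
wlog mn : m n / m <= n => [wlog_mn|].
  have [/wlog_mn//|/ltnW/wlog_mn nm /esym/nm //] := leqP m n.
rewrite -{1}(subnK mn) iterD => /esym/parent_acyclic/eqP.
by rewrite subn_eq0 => nm; apply/eqP; rewrite eqn_leq mn.
Qed.

(** An elliptic element that fixes the end but moves the n-th vertex of the
    ray carries the half-tree behind that vertex to a disjoint one: it
    preserves the number of steps to a later vertex of the ray. *)
Lemma moved_branch_disjoint (h : aut T) n x : commutes p h ->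
  (exists l, h 'x_l = 'x_l) -> h 'x_n <> 'x_n ->
  below p 'x_n x -> ~ below p 'x_n (h x).
Proof.
move=> hp [l hl] hn [k xk] [i xk']; apply: hn.
have hxk : iter k p (h x) = h 'x_n by rewrite -commutes_iter// xk.
have hl' : h 'x_(l + n) = 'x_(l + n).
  by apply: fix_mono hl => //; exact: leq_addr.
have ik : l + i = l + k.
  apply: (@iter_parent_inj (h x)).
  by rewrite !iterD xk' hxk -commutes_iter// -iterD hl' iterD.
by rewrite -hxk -(addnI ik).
Qed.

Lemma elliptic_end_stabilizer_howe_moore (R : realType) :
  relative_howe_moore R H.
Proof.
apply: (@howe_moore_criterion _ _ _ branch_fixer branch_supported fixer).
- by [].
- move=> m g h gfix hfix x bx.
  by rewrite -[RHS](gfix _ bx) -[in RHS](hfix _ bx).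
- exact: branch_fixer_base.
- move=> m n mn g gsupp x nbx; apply: gsupp => bx; apply: nbx.
  exact: below_mono bx.
- exact: branch_supported_dense.
- move=> m n; exists (maxn m n) => h g.
  move=> /elliptic_end_stabilizerP[hp hell] hk gn x bx.
  have /= gh : (\val g : aut T) ((\val h : aut T) x) = (\val h : aut T) x.
    apply: gn => /(below_mono (leq_maxr m n)).
    apply: moved_branch_disjoint => //.
    exact: below_mono (leq_maxl m n) bx.
  rewrite -[LHS]/((\val h : aut T)^-1%g
    ((\val g : aut T) ((\val h : aut T) x))).
  by rewrite gh autVK.
- exact: fixer_compact.
Qed.

End EndStabilizer.

Theorem theorem1p5 (R : realType) (d : nat) (T : regularTree d)
    (iota : set T -> 'I_d) (F : {group 'S_d}) (xi : set (nat -> T)) :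
  (3 <= d)%N ->
  legal_coloring iota ->
  [primitive F, on [set: 'I_d]%SET | 'P] ->
  ~ (cyclic F /\ prime #|F|) ->
  ends xi ->
  let G := universal_group_plus iota F in
  let H := elliptic_end_stabilizer (G := G) xi in
  closed_subgroup H /\ relative_howe_moore R H.
Proof.
move=> _ _ _ _ xi_end G H.
have [p [adj_parent parent_meet parent_acyclic xiE]] := end_parent xi_end.
have [x0] := vertex_inhabited T.
rewrite /H xiE; split; last exact: (elliptic_end_stabilizer_howe_moore
  adj_parent parent_meet parent_acyclic x0).
split.
  exact: (@elliptic_end_stabilizer_group _ _ iota F _ parent_meet x0).
exact: (elliptic_end_stabilizer_closed parent_meet x0).
Qed.
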